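(* For every $k \geq 3$, $q\geq 2$, and $n\geq 2$ we have $$N_k(q,n) \leq t_{k-2}(N_3(q,n)) .$$
   Context: The parameters $k,q,n$ are integers. Let $K^k_N$ denote the complete $k$-uniform hypergraph on the ordered vertex set $\{1,\ldots,N\}$, i.e. all $k$-element subsets of $\{1,\ldots,N\}$. For vertices $x_1<x_2<\cdots<x_{n+k-1}$, the $n$ edges $\{x_i,x_{i+1},\ldots,x_{i+k-1}\}$, $1\le i\le n$, form a monotone path of length $n$ (length is the number of edges). $N_k(q,n)$ is the smallest integer $N$ such that every coloring of the edges of $K^k_N$ with $q$ colors contains a monochromatic monotone path of length $n$ (all $n$ edges having the same color). The tower function $t_k(x)$ is a tower of exponents (of base $2$) of height $k-1$ with $x$ at the top: $t_1(x)=x$ and $t_k(x)=2^{t_{k-1}(x)}$ for $k\ge 2$ (so $t_3(x)=2^{2^x}$). *)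

(* Defs.v *)
From HB Require Import structures.
From mathcomp Require Import all_boot zify.

Set Implicit Arguments.
Unset Strict Implicit.
Unset Printing Implicit Defensive.

(* Vertices are 'I_N = {0, ..., N - 1} with its natural order, in place of
   {1, ..., N}. *)
Definition edge (k N : nat) := {e : {set 'I_N} | #|e| == k}.

Definition coloring (k q N : nat) := {ffun edge k N -> 'I_q}.

(* With x = (x_1, ..., x_{n+k-1}) stored from index 0, this is
   {x_{i+1}, ..., x_{i+k}}. *)
Definition path_edge (k N : nat) (x : seq 'I_N) (i : nat) : {set 'I_N} :=
  [set v in take k (drop i x)].

Definition has_mono_path (k q n N : nat) (c : coloring k q N) : bool :=
  [exists x : (n + k - 1).-tuple 'I_N,
     sorted [rel u v : 'I_N | u < v] x &&
     [exists a : 'I_q, [forall e : edge k N,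
        [exists i : 'I_n, val e == path_edge k x i] ==> (c e == a)]]].

Definition forces_mono_path (k q n N : nat) : bool :=
  [forall c : coloring k q N, has_mono_path n c].

(* The next lemmas show that N_k(q, n) is well defined.  [extends] says that
   a monotone path with m edges, all of color a, starts with the list t. *)
Fixpoint extends (C : eqType) (N : nat) (c : seq nat -> C) (a : C)
    (t : seq nat) (m : nat) : bool :=
  if m is m'.+1 then
    has (fun z => [&& sorted ltn (rcons t z), c (rcons t z) == a &
                      extends N c a (behead (rcons t z)) m']) (iota 0 N)
  else true.

Lemma extends_path (C : eqType) N (c : seq nat -> C) a k m t :
  0 < k -> size t = k -> sorted ltn t -> all (gtn N) t -> extends N c a t m ->
  exists s, [/\ sorted ltn s, all (gtn N) s, size s = m + k, take k s = t &
    forall i, i < m -> c (take k.+1 (drop i s)) = a].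
Proof.
move=> k_gt0; elim: m t => [|m IHm] t szt st Nt /=.
  by move=> _; exists t; split=> //; rewrite -szt take_size.
case/hasP=> z; rewrite mem_iota add0n => /= zN /and3P[stz /eqP ctz].
case: t szt st Nt stz ctz => [|x u] /= szt st Nt stz ctz ext.
  by rewrite -szt in k_gt0.
have [xN uN] := andP Nt.
have [|||s [ss Ns szs tks cs]] := IHm (rcons u z) _ _ _ ext.
- by rewrite size_rcons.
- exact: path_sorted stz.
- by rewrite all_rcons /= zN.
exists (x :: s); split=> //=.
- case: s ss tks {Ns szs cs} => //= y s ss tks.
  rewrite ss andbT; move: stz; rewrite -tks.
  by case: (k) k_gt0 => // k' _ /= /andP[].
- by rewrite xN.
- by rewrite szs.
- by rewrite -szt /= -(take_takel s (leqnSn _)) szt tks -cats1 take_size_cat.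
case=> [_|i]; last by rewrite ltnS => /cs.
by rewrite drop0 /= tks.
Qed.

Lemma mono_list_exists k (C : finType) n : exists N, forall c : seq nat -> C,
  exists s a, [/\ sorted ltn s, all (gtn N) s, size s = n + k - 1 &
    forall i, i < n -> c (take k (drop i s)) = a].
Proof.
case: k => [|k].
  exists n => c; exists (iota 0 (n - 1)), (c [::]).
  split=> [|||i _]; last by rewrite take0.
  - exact: iota_ltn_sorted.
  - by apply/allP=> x; rewrite mem_iota /=; lia.
  - by rewrite size_iota addn0.
elim: k => [|k IHk] in C n *.
  exists (#|C| * n).+1 => c.
  pose cls a := [seq x <- iota 0 (#|C| * n).+1 | c [:: x] == a].
  have [a na]: exists a, n <= size (cls a).
    apply/existsP; apply: contraT => /existsPn small.
    have: \sum_(a : C) size (cls a) <= #|C| * n.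
      rewrite -sum_nat_const; apply: leq_sum => a _.
      by have := small a; rewrite -ltnNge => /ltnW.
    rewrite leqNgt => /negP; case.
    under eq_bigr => a _ do rewrite size_filter -sum1_count big_mkcond /=.
    rewrite exchange_big -{1}(size_iota 0 (#|C| * n).+1) -sum1_size.
    apply: eq_leq; apply: eq_bigr => x _.
    by rewrite -big_mkcond (big_pred1 (c [:: x])) // => a; rewrite eq_sym.
  exists (take n (cls a)), a; split.
  - apply/take_sorted/sorted_filter; first exact: ltn_trans.
    exact: iota_ltn_sorted.
  - apply/allP=> x /mem_take; rewrite mem_filter mem_iota /=; lia.
  - by rewrite addnK size_takel.
  move=> i ltin; have szi: i < size (take n (cls a)) by rewrite size_takel.
  rewrite (drop_nth 0 szi) /= take0.
  by have := mem_take (mem_nth 0 szi); rewrite mem_filter => /andP[/eqP].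
have [N HN] := IHk {ffun C -> 'I_n.+1} 2; exists N => c.
have mono t a : size t = k.+1 -> sorted ltn t -> all (gtn N) t ->
    extends N c a t n ->
  exists s b, [/\ sorted ltn s, all (gtn N) s, size s = n + k.+2 - 1 &
    forall i, i < n -> c (take k.+2 (drop i s)) = b].
  move=> szt st Nt /(extends_path (ltn0Sn k) szt st Nt)[s [? ? szs _ ?]].
  by exists s, a; split=> //; rewrite szs; lia.
pose f t := [ffun a => [arg max_(m > (ord0 : 'I_n.+1) | extends N c a t m) m]].
have fP t a : extends N c a t (f t a) /\
    forall m : 'I_n.+1, extends N c a t m -> m <= f t a.
  by rewrite ffunE; case: arg_maxnP.
have [w [g [sw Nw szw fw]]] := HN f.
have {}szw : size w = k.+2 by rewrite szw; lia.
case: (lastP w) szw sw Nw fw => // t z; rewrite size_rcons => -[szt] sw Nw fw.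
have ft: f t = f (behead (rcons t z)).
  have := fw 1 isT; rewrite -(fw 0 isT) drop0 drop1 -cats1 -szt.
  rewrite take_size_cat // take_oversize //.
  by rewrite size_behead size_cat /= addn1.
have := sw; rewrite -cats1 => /cat_sorted2[st _].
have := Nw; rewrite all_rcons => /andP[zN Nt].
set a := c (rcons t z); have [ext _] := fP (behead (rcons t z)) a.
have [lt_n|ge_n] := ltnP (f (behead (rcons t z)) a) n; last first.
  have fn: f (behead (rcons t z)) a = n :> nat.
    by apply/eqP; rewrite eqn_leq ge_n -ltnS ltn_ord.
  apply: (mono t a) => //; rewrite -fn -ft.
  exact: (fP t a).1.
have ext1: extends N c a t (f (behead (rcons t z)) a).+1.
  by apply/hasP; exists z; rewrite ?mem_iota // sw eqxx.
have := (fP t a).2 (Ordinal (lt_n : _.+1 < n.+1)) ext1.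
by rewrite ft ltnn.
Qed.

Lemma forces_mono_path_exists k q n : exists N, forces_mono_path k q n N.
Proof.
have [N HN] := mono_list_exists k 'I_q n; exists (N + k).
apply/forallP=> c.
have e0P : #|[set rshift N i | i in 'I_k]| == k.
  by rewrite card_imset ?card_ord //; apply: rshift_inj.
pose e0 : edge k (N + k) := exist (fun e : {set _} => #|e| == k) _ e0P.
pose c' (t : seq nat) := c (insubd e0 [set v : 'I_(N + k) | val v \in t]).
have [s [a [ss Ns szs cs]]] := HN c'.
pose x : seq 'I_(N + k) := pmap insub s.
have valx : map val x = s.
  rewrite (pmap_filter (insubK _)); apply/all_filterP.
  by apply/allP => y /(allP Ns) /= yN; rewrite isSome_insub ltn_addr.
have szx : size x == n + k - 1 by rewrite -szs -valx size_map.
apply/existsP; exists (Tuple szx); apply/andP; split.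
  by move: ss; rewrite -valx sorted_map.
apply/existsP; exists a; apply/forallP => e; apply/implyP.
case/existsP => i /eqP ei; apply/eqP; rewrite -(cs i) // /c'.
congr (c _); rewrite -[LHS](valKd e0) ei; congr (insubd _ _).
apply/setP => v; rewrite !inE -valx -map_drop -map_take mem_map //.
exact: val_inj.
Qed.

Definition path_ramsey (k q n : nat) : nat :=
  ex_minn (forces_mono_path_exists k q n).

Definition tower (k x : nat) : nat := iter k.-1 (expn 2) x.

(* Main.v *)
Require Import Defs.
From mathcomp Require Import all_boot zify.

(** Why the bound holds.  It is enough to lose one exponential per step:
    if every q-coloring of the k-subsets of an N-set has a monochromatic
    monotone path of length n, then so has every q-coloring of the
    (k+1)-subsets of a (2 ^ N)-set, for k >= 2 ([forces_mono_pathS]).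

    Path-free colorings are the same thing as labelings in a poset.  Given a
    coloring of the (k+1)-subsets without a path of length n, label an
    increasing k-list t by the vector whose entry at the color a is the length
    of the longest path of color a that starts with t.  Each entry is below n,
    and when t is shifted by one vertex the entry at the color of the edge
    passed over drops.  So the label of t is never pointwise below the label of
    its shift.  Conversely, from labels in {0, ..., n-1}^q with this property
    one colors each edge by an entry that drops; along a path of color a the
    a-th entry then drops n times, which is impossible
    ([labelable_of_coloring], [coloring_of_labelable]).

    Such labelings trade list length for poset size: k-lists can be labeled in
    the poset of down-sets of r if and only if (k+1)-lists can be labeled in r
    ([labelable_downsets], [labelable_of_downsets]).  This is the adjunction
    between the line digraph construction and its right adjoint, specialized
    to digraphs with an arc from x to y when x is not below y.  By iterating it
    one comes down to 1-lists, that is, to single vertices, which can be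
    labeled exactly when there are at most as many of them as elements of the
    poset ([labelable_leq_card], [labelable_card]).  A poset with m elements has
    at most 2 ^ m down-sets, and so a labeling of the (k+1)-lists over 2 ^ N
    vertices yields one of the k-lists over N vertices ([labelable_expn]). *)

Set Implicit Arguments.
Unset Strict Implicit.
Unset Printing Implicit Defensive.

(** * Labelings of increasing lists in a poset *)

Definition increasing_list (k N : nat) (s : seq nat) : bool :=
  [&& sorted ltn s, all (gtn N) s & size s == k].

(** For k = 1 the condition says that the labels of increasing vertices could
    appear in this order in a reverse linear extension of [r]. *)
Definition labelable (T : Type) (r : rel T) (k N : nat) : Prop :=
  exists f : seq nat -> T, forall s, increasing_list k.+1 N s ->
    ~~ r (f (take k s)) (f (behead s)).

Definition downset (T : finType) (r : rel T) : pred {set T} :=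
  [pred A : {set T} | [forall y in A, forall x, r x y ==> (x \in A)]].

Definition subset_order (T : finType) (r : rel T) : rel {A | downset r A} :=
  fun A B => val A \subset val B.

Lemma take_rcons_size (T : Type) k (t : seq T) z :
  size t = k -> take k (rcons t z) = t.
Proof. by move=> <-; rewrite -cats1 take_size_cat. Qed.

Lemma behead_take (T : Type) k (s : seq T) :
  behead (take k.+1 s) = take k (behead s).
Proof. by case: s. Qed.

Lemma increasing_take k N s :
  increasing_list k.+1 N s -> increasing_list k N (take k s).
Proof.
case/and3P=> ss Ns /eqP szs; apply/and3P; split; first exact: take_sorted.
  by apply/allP=> x /mem_take /(allP Ns).
by rewrite size_takel // szs.
Qed.

Lemma increasing_behead k N s :
  increasing_list k.+1 N s -> increasing_list k N (behead s).
Proof.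
case/and3P; case: s => //= x s ss /andP[_ Ns] szs.
by rewrite /increasing_list (path_sorted ss) Ns.
Qed.

(** A k-list gets the down-set generated by the labels of its one-vertex
    extensions to the right.  If s is a list of k+1 vertices, the label of s is
    in the down-set of its first k entries; if it were in the down-set of the
    last k entries, it would be below the label of a shift of s.  For k = 0 the
    last step breaks down: the new vertex need not be above s. *)
Lemma labelable_downsets (T : finType) (r : rel T) k N :
  reflexive r -> transitive r -> 0 < k ->
  labelable r k.+1 N -> labelable (@subset_order T r) k N.
Proof.
move=> r_refl r_trans k_gt0 [f fP].
pose out t := [set p | has (fun z => increasing_list k.+1 N (rcons t z)
                                     && r p (f (rcons t z))) (iota 0 N)].
have out_down t : downset r (out t).
  apply/forall_inP=> y; rewrite inE => /hasP[z zN /andP[inc ryz]].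
  apply/forallP=> x; apply/implyP=> rxy; rewrite inE; apply/hasP; exists z => //.
  by rewrite inc (r_trans y).
exists (fun t => exist (downset r) (out t) (out_down t)) => s incs /=.
have [ss Ns /eqP szs] := and3P incs.
apply/negP=> /subsetP /(_ (f s)); rewrite !inE => sub.
have {}sub : has (fun z => increasing_list k.+1 N (rcons (behead s) z)
                           && r (f s) (f (rcons (behead s) z))) (iota 0 N).
  apply: sub; apply/hasP; case: (lastP s) szs Ns incs => // t z.
  rewrite size_rcons all_rcons => -[szt] /andP[zN _] inc.
  exists z; first by rewrite mem_iota.
  by rewrite take_rcons_size // inc r_refl.
have [z zN /andP[/and3P[sz Nz _] rsz]] := hasP sub.
suff /fP : increasing_list k.+2 N (rcons s z).
  rewrite take_rcons_size //; move: rsz szs.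
  by case: (s) => //= x t ->.
rewrite /increasing_list size_rcons szs eqxx andbT.
move: Nz; rewrite !all_rcons Ns => /andP[-> _]; rewrite andbT.
case: (s) szs ss sz k_gt0 => [|x [|y t]] //=; first by move=> [<-].
by move=> _ /andP[-> _] ->.
Qed.

(** A (k+1)-list is labeled by a witness that the down-set U of its first k
    entries is not included in the down-set V of its last k entries.  The label
    of the next shift is in V by construction; so the label of the list, being
    outside V, cannot be below it. *)
Lemma labelable_of_downsets (T : finType) (r : rel T) (x0 : T) k N :
  labelable (@subset_order T r) k N -> labelable r k.+1 N.
Proof.
case=> F FP.
pose D s := val (F (take k s)) :\: val (F (behead s)).
exists (fun s => odflt x0 [pick p in D s]) => s incs.
have pickD u : increasing_list k.+1 N u ->
    odflt x0 [pick p in D u] \in D u.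
  move=> /FP /subsetPn[p pF pnF]; case: pickP => //= /(_ p).
  by rewrite inE pF pnF.
have := pickD _ (increasing_take incs); have := pickD _ (increasing_behead incs).
set p := odflt _ _; set p' := odflt _ _.
rewrite !inE take_takel // => /andP[_ pin] /andP[p'nin _].
apply: contra p'nin => rpp.
rewrite behead_take.
by apply: (implyP (forallP (forall_inP (valP (F _)) _ pin) _)).
Qed.

Lemma labelable_leq_card (T : finType) (r : rel T) N :
  reflexive r -> labelable r 1 N -> N <= #|T|.
Proof.
move=> r_refl [f fP]; rewrite -(card_ord N).
have fne (i j : 'I_N) : i < j -> f [:: val i] != f [:: val j].
  move=> ltij; have /fP /= : increasing_list 2 N [:: val i; val j].
    by rewrite /increasing_list /= ltij !ltn_ord.
  by apply: contra => /eqP->.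
apply: (@leq_card _ _ (fun i : 'I_N => f [:: val i])) => i j /eqP eqf.
apply/val_inj/eqP; case: ltngtP => // /fne; last rewrite eq_sym.
  by rewrite eqf.
by rewrite eqf.
Qed.

(** Vertices are labeled along a reverse linear extension, obtained by sorting
    the poset by the number of elements above. *)
Lemma labelable_card (T : finType) (r : rel T) (x0 : T) N :
  reflexive r -> antisymmetric r -> transitive r -> N <= #|T| ->
  labelable r 1 N.
Proof.
move=> r_refl r_anti r_trans leN.
pose up x := #|[set y | r x y]|; pose leup := relpre up leq.
have up_lt x y : r x y -> x != y -> up y < up x.
  move=> rxy xy; apply/proper_card/properP; split.
    by apply/subsetP=> z; rewrite !inE; apply: r_trans.
  exists x; rewrite !inE ?r_refl //; apply: contra xy => ryx.
  by apply/eqP/r_anti; rewrite rxy.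
pose e := sort leup (enum T).
have sz_e : size e = #|T| by rewrite size_sort cardE.
exists (fun s => nth x0 e (head 0 s)) => s /and3P[].
case: s => [|x [|y []]] //= /andP[ltxy _] /and3P[xN yN _] _.
have [xe ye] : x < size e /\ y < size e by rewrite sz_e; lia.
apply/negP=> /up_lt; rewrite nth_uniq ?sort_uniq ?enum_uniq ?ltn_eqF //.
move=> /(_ isT); apply/negP; rewrite -leqNgt.
have leup_trans : transitive leup by move=> ? ? ?; apply: leq_trans.
apply: (sorted_ltn_nth leup_trans x0 _ x y) => //.
by apply: sort_sorted => u v; apply: leq_total.
Qed.

Lemma subset_order_refl (T : finType) (r : rel T) :
  reflexive (@subset_order T r).
Proof. by move=> A; apply: subxx. Qed.

Lemma subset_order_anti (T : finType) (r : rel T) :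
  antisymmetric (@subset_order T r).
Proof. by move=> A B; rewrite -eqEsubset => /eqP/val_inj. Qed.

Lemma subset_order_trans (T : finType) (r : rel T) :
  transitive (@subset_order T r).
Proof. by move=> A B C; apply: subset_trans. Qed.

Lemma card_downset (T : finType) (r : rel T) :
  #|{: {A | downset r A}}| <= 2 ^ #|T|.
Proof.
rewrite card_sig -cardsT -card_powerset.
by apply/subset_leq_card/subsetP=> A _; rewrite powersetE subsetT.
Qed.

(** Moving to the poset of down-sets lowers k on both sides, so only the case
    k = 1 needs counting: there 2 ^ N is at most the number of down-sets, hence
    at most 2 ^ #|T|. *)
Lemma labelable_expn (T : finType) (r : rel T) (x0 : T) k N :
  reflexive r -> antisymmetric r -> transitive r -> 0 < k ->
  labelable r k.+1 (2 ^ N) -> labelable r k N.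
Proof.
case: k => // k + + + _.
elim: k => [|k IHk] in T r x0 * => r_refl r_anti r_trans lab.
  apply: labelable_card => //.
  have := leq_trans (labelable_leq_card (@subset_order_refl T r)
                       (@labelable_downsets _ r 1 _ r_refl r_trans isT lab))
                    (card_downset r).
  by rewrite leq_exp2l.
have set0_down : downset r set0 by apply/forall_inP=> y; rewrite inE.
apply: (labelable_of_downsets x0).
apply: (IHk _ _ (exist (downset r) set0 set0_down)).
- exact: subset_order_refl.
- exact: subset_order_anti.
- exact: subset_order_trans.
exact: labelable_downsets.
Qed.

(** * Path-free colorings as labelings *)

Definition pointwise_leq (q n : nat) : rel {ffun 'I_q -> 'I_n} :=
  fun f g => [forall a, f a <= g a].

Lemma pointwise_leq_refl q n : reflexive (@pointwise_leq q n).
Proof. by move=> f; apply/forallP=> a. Qed.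

Lemma pointwise_leq_anti q n : antisymmetric (@pointwise_leq q n).
Proof.
move=> f g /andP[/forallP lefg /forallP legf]; apply/ffunP=> a.
by apply/val_inj/eqP; rewrite eqn_leq lefg legf.
Qed.

Lemma pointwise_leq_trans q n : transitive (@pointwise_leq q n).
Proof.
move=> g f h /forallP lefg /forallP legh; apply/forallP=> a.
exact: leq_trans (lefg a) (legh a).
Qed.

Definition vertex_set (N : nat) (t : seq nat) : {set 'I_N} :=
  [set v | val v \in t].

Lemma vertex_set_map N (x : seq 'I_N) : vertex_set N (map val x) = [set v in x].
Proof. by apply/setP=> v; rewrite !inE mem_map //; apply: val_inj. Qed.

Lemma map_val_pmap_insub N s :
  all (gtn N) s -> map val (pmap insub s : seq 'I_N) = s.
Proof.
move=> Ns; rewrite (pmap_filter (insubK _)); apply/all_filterP.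
by apply/allP=> y /(allP Ns) /= yN; rewrite isSome_insub.
Qed.

(** The label of a list is the vector of the lengths of the longest
    monochromatic paths that start with it. *)
Lemma labelable_of_coloring k q n N (a0 : 'I_q) (c : coloring k.+1 q N) :
  0 < n -> 0 < k -> ~~ has_mono_path n c -> labelable (@pointwise_leq q n) k N.
Proof.
case: n => // n _ k_gt0 noc.
(* [a0] is a default value for lists that do not span an edge. *)
pose c' t := oapp c a0 (insub (vertex_set N t)).
have no_path t a : increasing_list k N t -> ~~ extends N c' a t n.+1.
  case/and3P=> st Nt /eqP szt; apply: contra noc.
  case/(extends_path k_gt0 szt st Nt) => s [ss Ns szs _ cs].
  pose x : seq 'I_N := pmap insub s.
  have valx : map val x = s by apply: map_val_pmap_insub.
  have szx : size x == n.+1 + k.+1 - 1.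
    by rewrite -(size_map val) valx szs; lia.
  apply/existsP; exists (Tuple szx); apply/andP; split.
    by move: ss; rewrite -valx sorted_map.
  apply/existsP; exists a; apply/forallP=> e; apply/implyP.
  case/existsP=> i /eqP ei; rewrite -(cs i) // /c'.
  by rewrite -valx -map_drop -map_take vertex_set_map -[[set _ in _]]ei valK.
(* The longest path of color [a] from [t] has at most n edges by [no_path], so
   capping the maximum at the type 'I_n.+1 loses nothing. *)
pose f t :=
  [ffun a => [arg max_(m > (ord0 : 'I_n.+1) | extends N c' a t m) m]].
have fP t a : extends N c' a t (f t a) /\
    forall m : 'I_n.+1, extends N c' a t m -> m <= f t a.
  by rewrite ffunE; case: arg_maxnP.
exists f => s incs; have [ss Ns /eqP szs] := and3P incs.
apply/forallPn; exists (c' s).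
have ext : extends N c' (c' s) (take k s) (f (behead s) (c' s)).+1.
  case: (lastP s) szs Ns ss incs => // t z; rewrite size_rcons all_rcons.
  move=> -[szt] /andP[zN _] stz _.
  apply/hasP; exists z; first by rewrite mem_iota.
  by rewrite take_rcons_size // stz eqxx; apply: (fP _ _).1.
have lt_n : (f (behead s) (c' s)).+1 < n.+1.
  rewrite ltn_neqAle ltn_ord andbT; apply/eqP=> fn.
  by have := no_path _ (c' s) (increasing_take incs); rewrite -fn ext.
by have := (fP (take k s) (c' s)).2 (Ordinal lt_n) ext; rewrite -ltnNge.
Qed.

Lemma enum_ord_sorted N (A : {set 'I_N}) :
  sorted [rel u v : 'I_N | u < v] (enum A).
Proof.
rewrite {1}/enum_mem; apply: sorted_filter.
  by move=> u v w; apply: ltn_trans.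
rewrite -enumT -[sorted _ _](@sorted_map _ _ val ltn) val_enum_ord.
exact: iota_ltn_sorted.
Qed.

Lemma enum_path_edge k N (x : seq 'I_N) i :
  sorted [rel u v : 'I_N | u < v] x ->
  enum (path_edge k x i) = take k (drop i x).
Proof.
move=> sx; apply: (@irr_sorted_eq _ [rel u v : 'I_N | u < v]).
- by move=> u v w; apply: ltn_trans.
- by move=> u; apply: ltnn.
- exact: enum_ord_sorted.
- exact/take_sorted/drop_sorted.
by move=> v; rewrite mem_enum inE.
Qed.

(** An edge is colored by an entry of the label that drops from its first k
    vertices to its last k vertices; an entry below n cannot drop n times. *)
Lemma coloring_of_labelable k q n N (a0 : 'I_q) :
  labelable (@pointwise_leq q n) k N ->
  exists c : coloring k.+1 q N, ~~ has_mono_path n c.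
Proof.
case=> f fP.
pose c' t := odflt a0 [pick a | f (behead t) a < f (take k t) a].
have c'P s : increasing_list k.+1 N s ->
    f (behead s) (c' s) < f (take k s) (c' s).
  move=> /fP /forallPn[a]; rewrite -ltnNge => lta.
  by rewrite /c'; case: pickP => //= /(_ a); rewrite lta.
exists [ffun e : edge k.+1 N => c' (map val (enum (val e)))].
apply/existsP=> -[x /andP[sx /existsP[a /forallP ca]]].
have szx : size x = n + k by rewrite size_tuple; lia.
have step i : i < n -> f (take k (drop i.+1 (map val x))) a <
                       f (take k (drop i (map val x))) a.
  move=> lt_in; pose s := map val (take k.+1 (drop i x)).
  have incs : increasing_list k.+1 N s.
    apply/and3P; split.
    - by rewrite sorted_map; apply/take_sorted/drop_sorted/sx.
    - by apply/allP=> _ /mapP[v _ ->] /=.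
    - by rewrite size_map size_takel // size_drop szx; lia.
  have szi : #|path_edge k.+1 x i| == k.+1.
    by rewrite cardE enum_path_edge // size_takel // size_drop szx; lia.
  pose e : edge k.+1 N := exist (fun e : {set _} => #|e| == k.+1) _ szi.
  have : c' s = a.
    have /implyP/(_ _)/eqP := ca e; rewrite ffunE /= enum_path_edge //.
    by apply; apply/existsP; exists (Ordinal lt_in).
  move=> c's; have := c'P s incs; rewrite c's /s map_take map_drop.
  by rewrite take_takel // behead_take -drop1 drop_drop add1n.
have bound i : i <= n -> f (take k (drop i (map val x))) a + i < n.
  elim: i => [|i IHi] lt_in; first by rewrite addn0.
  by have := step i lt_in; have := IHi (ltnW lt_in); lia.
by have := bound n (leqnn n); lia.
Qed.

(** * The exponential step and its iteration *)

Lemma forces_mono_pathS k q n N :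
  0 < q -> 0 < n -> 1 < k ->
  forces_mono_path k q n N -> forces_mono_path k.+1 q n (2 ^ N).
Proof.
case: q n k => // q [|n] // [|k] // _ _ k_gt0 force.
apply/forallP=> c; apply: contraT => noc.
have := labelable_of_coloring ord0 (ltn0Sn n) (ltn0Sn k) noc.
move=> /(labelable_expn [ffun=> ord0] (@pointwise_leq_refl _ _)
  (@pointwise_leq_anti _ _) (@pointwise_leq_trans _ _) k_gt0).
case/(coloring_of_labelable ord0) => c'.
by rewrite (forallP force).
Qed.

Lemma path_ramsey_forces k q n : forces_mono_path k q n (path_ramsey k q n).
Proof. by rewrite /path_ramsey; case: ex_minnP. Qed.

Lemma path_ramsey_leq k q n N :
  forces_mono_path k q n N -> path_ramsey k q n <= N.
Proof. by rewrite /path_ramsey; case: ex_minnP => m _; apply. Qed.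

Theorem theorem3 (k q n : nat) (hk : 3 <= k) (hq : 2 <= q) (hn : 2 <= n) :
  path_ramsey k q n <= tower (k - 2) (path_ramsey 3 q n).
Proof.
apply: path_ramsey_leq; rewrite -(subnKC hk) addSn.
have -> : (2 + (k - 3)).+1 - 2 = (k - 3).+1 by lia.
rewrite /tower /=; elim: (k - 3) => [|j IHj]; first exact: path_ramsey_forces.
by rewrite addnS iterS; apply: forces_mono_pathS => //; lia.
Qed.
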